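(* Let $\alpha=(\alpha_0,\dots,\alpha_{N-1})\in\triangle_N^*$. If $\alpha_{N-1}=0$, then $I_m\le\left(\frac{N-1}{N}\right)^m$ for all integers $m\ge0$. Otherwise (if $\alpha_{N-1}>0$), there exists a constant $C(\alpha)>0$ such that $I_m\ge C(\alpha)\,m^{-\gamma}$ for all integers $m\ge1$, where $\gamma=\log_N(1/\alpha_{N-1})$.
   Context: $\triangle_N$ is the set of $\alpha=(\alpha_0,\dots,\alpha_{N-1})\in\mathbb{R}^N$ with all $\alpha_n\ge 0$ and $\sum_n\alpha_n=1$, and $\triangle_N^*\subseteq\triangle_N$ consists of those $\alpha$ with $\alpha_n<1$ for all $n$ (so $\triangle_N^*$ is nonempty only for $N\ge2$). For $\alpha\in\triangle_N$ with $N\ge2$, the $\alpha$-weighted Cantor measure $\mu^\alpha$ is the unique Borel probability measure on $\mathbb{R}$ supported in $[0,1]$ satisfying $\mu^\alpha(E)=\sum_{n=0}^{N-1}\alpha_n\mu^\alpha(\varphi_n^{-1}(E))$ for all Borel sets $E$, where $\varphi_n(x)=(x+n)/N$. Its $m$-th moment is $I_m=\int_0^1x^m\,d\mu^\alpha(x)$. *)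

(* Defs.v *)
From HB Require Import structures.
From mathcomp Require Import all_boot all_order all_algebra.
From mathcomp Require Import all_classical all_reals all_analysis.

Set Implicit Arguments.
Unset Strict Implicit.
Unset Printing Implicit Defensive.

Import Order.TTheory GRing.Theory Num.Theory.
Import numFieldNormedType.Exports.

Local Open Scope classical_set_scope.
Local Open Scope ring_scope.

Definition simplex (R : realType) (N : nat) : set ('I_N -> R) :=
  [set alpha | (forall n, 0 <= alpha n) /\ \sum_(n < N) alpha n = 1].

Definition simplex_star (R : realType) (N : nat) : set ('I_N -> R) :=
  [set alpha | simplex alpha /\ forall n, alpha n < 1].

Definition phi (R : realType) (N : nat) (n : 'I_N) (x : R) : R :=
  (x + n%:R) / N%:R.

(* For 2 <= N and alpha in the simplex, exactly one Borel probability measure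
   satisfies these two conditions; the first one says that its support is
   contained in [0, 1]. *)
Definition weighted_cantor_measure (R : realType) (N : nat)
    (alpha : 'I_N -> R) (mu : probability (measurableTypeR R) R) : Prop :=
  mu (~` `[0, 1]) = 0%E /\
  forall E : set (measurableTypeR R), measurable E ->
    mu E = (\sum_(n < N) (alpha n)%:E * mu (phi n @^-1` E))%E.

Definition moment (R : realType) (mu : probability (measurableTypeR R) R)
    (m : nat) : R :=
  \int[mu]_(x in `[0, 1]) (x ^+ m).

Definition log_base (R : realType) (b x : R) : R := ln x / ln b.

(* Main.v *)
(* Since phi_n maps [0, 1] into [0, (N-1)/N] for n < N-1, if the last weight
   vanishes then mu lives on [0, (N-1)/N].  Otherwise, iterating the last map k
   times gives mu [1 - N^-k, 1] >= alpha_(N-1)^k, so that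
   I_m >= alpha_(N-1)^k (1 - N^-k)^m.  With k = floor(log_N m) + 2 one has
   m N^-k <= 1/2, so the second factor is at least 1/2 by Bernoulli's inequality,
   and the first one is at least alpha_(N-1)^2 m^-gamma. *)
Require Import Defs.
From mathcomp Require Import all_boot all_order all_algebra.
From mathcomp Require Import all_classical all_reals all_analysis.
From mathcomp Require Import measurable_realfun zify lra.

Set Implicit Arguments.
Unset Strict Implicit.
Unset Printing Implicit Defensive.

Import Order.TTheory GRing.Theory Num.Theory.
Import numFieldNormedType.Exports.

Local Open Scope classical_set_scope.
Local Open Scope ring_scope.

Lemma bernoulli_ineq (R : realDomainType) (x : R) (m : nat) :
  0 <= x <= 1 -> 1 - m%:R * x <= (1 - x) ^+ m.
Proof.
move=> /andP[x0 x1]; elim: m => [|m IH]; first by rewrite mul0r subr0 expr0.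
rewrite exprS -natr1.
have m0 : 0 <= m%:R :> R by [].
have : (1 - x) * (1 - m%:R * x) <= (1 - x) * (1 - x) ^+ m.
  by apply: ler_wpM2l => //; rewrite subr_ge0.
by apply: le_trans; nra.
Qed.

(** The index [l] excludes [N = 0]; for [N = 1] the only weight would be the whole sum 1, against
    strictness. *)
Lemma simplex_star_gt1 (R : realType) (N : nat) (alpha : 'I_N -> R) (l : 'I_N) :
  simplex_star alpha -> (1 < N)%N.
Proof.
case: N alpha l => [|[|//]] alpha l; first by case: l.
by move=> [[_]] + /(_ ord0); rewrite big_ord1 => ->; rewrite ltxx.
Qed.

Lemma measurable_phi (R : realType) (N : nat) (n : 'I_N) :
  measurable_fun [set: measurableTypeR R] (phi (R := R) n).
Proof.
by apply: measurable_funM => //; apply: measurable_funD.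
Qed.

Lemma measurable_EFin_exprn (R : realType) (D : set (measurableTypeR R))
    (m : nat) :
  measurable_fun D (fun x : measurableTypeR R => (x ^+ m : R)%:E).
Proof. by apply/measurable_EFinP; exact: exprn_measurable. Qed.

Section moment_bounds.
Variables (R : realType) (mu : probability (measurableTypeR R) R).

Lemma integral_exprn_le (m : nat) (c : R) : 0 <= c -> mu (~` `[0, c]) = 0%E ->
  (\int[mu]_(x in `[0%R, 1%R]) (x ^+ m)%:E <= (c ^+ m)%:E)%E.
Proof.
move=> c0 muc.
have mc : measurable (~` `[0, c] : set (measurableTypeR R)).
  exact: measurableC.
rewrite (ge0_negligible_integral mc)//; last 2 first.
- exact: measurable_EFin_exprn.
- by move=> x /=; rewrite in_itv/= lee_fin => /andP[x0 _]; exact: exprn_ge0.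
have mD : measurable (`[0, 1] `\` ~` `[0, c] : set (measurableTypeR R)).
  exact: measurableD.
apply: (@le_trans _ _ (\int[mu]_(x in (`[0%R, 1%R] `\` ~` `[0%R, c])) (cst (c ^+ m)%:E x))%E).
  apply: ge0_le_integral => //.
  - move=> x /= [+ _]; rewrite in_itv/= lee_fin => /andP[x0 _].
    exact: exprn_ge0.
  - exact: measurable_EFin_exprn.
  - move=> x [_] /= /contrapT; rewrite in_itv/= lee_fin => /andP[x0 xc].
    by apply: lerXn2r.
rewrite integral_cst// -[leRHS]mule1 lee_wpmul2l ?lee_fin ?exprn_ge0//.
exact: probability_le1.
Qed.

(** [moment] goes through [fine], which sends infinite values to 0. Finiteness lets bounds on the
    extended integral pass to the real moment. *)
Lemma moment_fin_num (m : nat) : mu (~` `[0, 1]) = 0%E ->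
  (\int[mu]_(x in `[0%R, 1%R]) (x ^+ m)%:E)%E \is a fin_num.
Proof.
move=> mu01; apply/fin_real/andP; split.
  apply: (@lt_le_trans _ _ 0%E) => //; apply: integral_ge0 => x /=.
  by rewrite in_itv/= lee_fin => /andP[x0 _]; exact: exprn_ge0.
apply: le_lt_trans (integral_exprn_le m ler01 mu01) _.
exact: ltry.
Qed.

Lemma moment_le (m : nat) (c : R) : mu (~` `[0, 1]) = 0%E ->
  0 <= c -> mu (~` `[0, c]) = 0%E -> moment mu m <= c ^+ m.
Proof.
move=> mu01 c0 muc; rewrite -lee_fin /moment /Rintegral fineK ?moment_fin_num//.
exact: integral_exprn_le.
Qed.

(** A Markov-type bound: shrink the domain to [[c, 1]], where the integrand is at least [c ^+ m]. *)
Lemma moment_ge (m : nat) (c p : R) : mu (~` `[0, 1]) = 0%E ->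
  0 <= c -> (p%:E <= mu `[c, 1%R]%classic)%E -> p * c ^+ m <= moment mu m.
Proof.
move=> mu01 c0 pc; rewrite -lee_fin /moment /Rintegral fineK ?moment_fin_num//.
apply: (@le_trans _ _ (\int[mu]_(x in `[c, 1%R]) (cst (c ^+ m)%:E x))%E).
  rewrite integral_cst// EFinM muleC.
  by apply: lee_wpmul2l => //; rewrite lee_fin exprn_ge0.
apply: (@le_trans _ _ (\int[mu]_(x in `[c, 1%R]) (x ^+ m)%:E)%E).
  apply: ge0_le_integral => //.
  - by move=> x _; rewrite lee_fin exprn_ge0.
  - exact: measurable_EFin_exprn.
  - move=> x /=; rewrite in_itv/= lee_fin => /andP[cx _].
    by apply: lerXn2r => //; rewrite nnegrE// (le_trans c0).
apply: ge0_subset_integral => //.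
- exact: measurable_EFin_exprn.
- by move=> x /=; rewrite in_itv/= lee_fin => /andP[x0 _]; exact: exprn_ge0.
- by move=> x /=; rewrite !in_itv/= => /andP[cx ->]; rewrite (le_trans c0).
Qed.

End moment_bounds.

Section cantor.
Variables (R : realType) (N : nat) (alpha : 'I_N -> R) (l : 'I_N).
Variable mu : probability (measurableTypeR R) R.
Hypothesis halpha : simplex_star alpha.
Hypothesis hl : nat_of_ord l = N.-1.
Hypothesis hmu : weighted_cantor_measure alpha mu.

Let N1 : (1 < N)%N. Proof. exact: simplex_star_gt1 l halpha. Qed.
Let N0 : 0 < N%:R :> R. Proof. by rewrite ltr0n ltnW. Qed.
Let lE : (l%:R : R) = N%:R - 1.
Proof. by rewrite hl -subn1 natrB// ltnW. Qed.

Lemma cantor_measure_support_last0 : alpha l = 0 ->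
  mu (~` `[0, (N%:R - 1) / N%:R]) = 0%E.
Proof.
move=> al; have [mu01 muE] := hmu.
have mE : measurable (~` `[0, (N%:R - 1) / N%:R] : set (measurableTypeR R)).
  exact: measurableC.
rewrite muE// big1// => n _.
have [->|nl] := eqVneq n l; first by rewrite al mul0e.
suff -> : mu (phi n @^-1` (~` `[0, (N%:R - 1) / N%:R])) = 0%E by rewrite mule0.
apply: (@subset_measure0 _ _ _ mu _ (~` `[0, 1])) => //.
- by rewrite -[X in measurable X]setTI; exact: measurable_phi.
- exact: measurableC.
(* As [n] is not the last index, [n + 1 <= N - 1], so [phi n] sends [[0, 1]] into
   [[0, (N - 1) / N]]; the inclusion of preimages is the contrapositive. *)
- have nN : (n%:R : R) + 1 <= N%:R - 1.
    rewrite lerBrDr !natr1 ler_nat.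
    by move: nl (ltn_ord n); rewrite -val_eqE/= hl; lia.
  move=> x /=; rewrite /phi; apply: contra_not.
  rewrite !in_itv/= => /andP[x0 x1].
  apply/andP; split; first by rewrite divr_ge0// addr_ge0.
  by rewrite ler_pM2r ?invr_gt0//; lra.
Qed.

(** Induction on [k], keeping only the term [l] of the self-similarity equation: [phi l] fixes 1 and
    contracts by [N], hence maps each of these intervals into the next one. *)
Lemma cantor_measure_right_end (k : nat) :
  ((alpha l ^+ k)%:E <= mu `[(1 - N%:R ^- k)%R, 1%R]%classic)%E.
Proof.
have [mu01 muE] := hmu; have [[al0 _] _] := halpha.
elim: k => [|k IH].
  (* For [k = 0] the interval is [[0, 1]], of full mass because its complement is null. *)
  rewrite !expr0 invr1 subrr -(setCK `[0, 1]%classic) probability_setC ?mu01 ?sube0//.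
  exact: measurableC.
rewrite muE// (bigD1 l)//= -[leLHS]adde0; apply: leeD; last first.
  by apply: sume_ge0 => n _; rewrite mule_ge0// lee_fin.
rewrite exprS EFinM lee_wpmul2l ?lee_fin//; apply: le_trans IH _.
apply: le_measure; rewrite ?inE//.
  by rewrite -[X in measurable X]setTI; exact: measurable_phi.
move=> x /=; rewrite /phi !in_itv/= lE => /andP[x0 x1].
have u : N%:R ^- k.+1 * N%:R = N%:R ^- k :> R.
  by rewrite exprSr invfM divfK ?gt_eqF.
by rewrite ler_pdivlMr// ler_pdivrMr// mulrBl u; apply/andP; split; lra.
Qed.

End cantor.

(** The left side is [a] to the power log_N m. This exponent is at least [trunc_log N m], and
    [a <= 1] reverses the comparison. *)
Lemma log_base_decay (R : realType) (N : nat) (a : R) (m : nat) :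
  (1 < N)%N -> 0 < a <= 1 -> (0 < m)%N ->
  m%:R `^ (- log_base N%:R (1 / a)) <= a ^+ trunc_log N m.
Proof.
move=> N1 /andP[a0 a1] m0; set t := trunc_log N m.
have N0 : 0 < N%:R :> R by rewrite ltr0n ltnW.
have lnN : 0 < ln (N%:R : R) by rewrite ln_gt0// ltr1n.
have -> : - log_base N%:R (1 / a) = ln a / ln N%:R :> R.
  by rewrite /log_base div1r lnV ?posrE// mulNr opprK.
have le_tm : t%:R * ln (N%:R : R) <= ln (m%:R : R).
  rewrite mulr_natl -lnXn// ler_ln ?posrE ?exprn_gt0// ?ltr0n//.
  by rewrite -natrX ler_nat trunc_logP.
rewrite /powR gt_eqF ?ltr0n//.
rewrite -[a in leRHS](lnK a0) -expRM_natl ler_expR.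
have q0 : ln a / ln N%:R <= 0 :> R by rewrite pmulr_lle0 ?invr_gt0// ln_le0.
apply: le_trans (ler_wnM2l q0 le_tm) _.
by rewrite mulrCA divfK// gt_eqF.
Qed.

Theorem theorem3p9 (R : realType) (N : nat) (alpha : 'I_N -> R)
    (halpha : simplex_star alpha)
    (l : 'I_N) (hl : nat_of_ord l = N.-1) :
  (alpha l = 0 ->
    forall mu : probability (measurableTypeR R) R,
      weighted_cantor_measure alpha mu ->
      forall m : nat, moment mu m <= ((N%:R - 1) / N%:R) ^+ m) /\
  (0 < alpha l ->
    exists C : R, 0 < C /\
      forall mu : probability (measurableTypeR R) R,
        weighted_cantor_measure alpha mu ->
        forall m : nat, (1 <= m)%N ->
          C * m%:R `^ (- log_base N%:R (1 / alpha l)) <= moment mu m).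
Proof.
have N1 := simplex_star_gt1 l halpha.
have N0 : 0 < N%:R :> R by rewrite ltr0n ltnW.
split=> [al mu hmu m|al].
  apply: moment_le; first by case: hmu.
    by rewrite divr_ge0// subr_ge0 ler1n ltnW.
  exact: cantor_measure_support_last0 halpha hl hmu al.
(* The square pays for the two iterations beyond [trunc_log N m], and the factor 1/2 is the
   Bernoulli bound; neither depends on [mu] or [m]. *)
exists (alpha l ^+ 2 / 2); split=> [|mu hmu m m1].
  by rewrite divr_gt0 ?exprn_gt0.
have al1 : alpha l <= 1 by case: halpha => _ /(_ l)/ltW.
set t := trunc_log N m; set k := t.+2.
have Nk : 0 < N%:R ^+ k :> R by exact: exprn_gt0.
have Nk01 : 0 <= (N%:R ^- k : R) <= 1.
  rewrite invr_ge0 (ltW Nk)/= invf_le1// -natrX ler1n expn_gt0.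
  by rewrite ltnW.
(* Of the two extra powers of [N], one makes [N ^ t.+1] exceed [m], and the other is at least 2 and
   supplies the factor 1/2. *)
have m_small : m%:R * N%:R ^- k <= 1 / 2 :> R.
  rewrite ler_pdivrMr// mulrAC ler_pdivlMr// mul1r -natrM -natrX ler_nat.
  rewrite /k expnSr leq_mul// ltnW// -/t.
  exact: trunc_log_ltn.
have half : 1 / 2 <= (1 - N%:R ^- k) ^+ m :> R.
  by apply: le_trans (bernoulli_ineq m Nk01); lra.
have mu01 : mu (~` `[0, 1]) = 0%E by case: hmu.
have /andP[_ Nk1] := Nk01.
have c0 : 0 <= 1 - N%:R ^- k :> R by rewrite subr_ge0.
have p := cantor_measure_right_end halpha hl hmu k.
apply: le_trans (moment_ge m mu01 c0 p).
apply: (@le_trans _ _ (alpha l ^+ k * (1 / 2))); last first.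
  by rewrite ler_wpM2l// exprn_ge0// ltW.
have a20 : 0 <= alpha l ^+ 2 / 2 by rewrite divr_ge0 ?exprn_ge0// ltW.
have al01 : 0 < alpha l <= 1 by rewrite al.
apply: le_trans (ler_wpM2l a20 (log_base_decay N1 al01 m1)) _.
have -> : alpha l ^+ k = alpha l ^+ t * alpha l ^+ 2 by rewrite -exprD addn2.
by rewrite -/t mulrC div1r mulrA.
Qed.
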